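(* Let $\mathcal{I}$ be a proper ideal of subsets of $\mathbb{N}$ which contains all finite subsets of $\mathbb{N}$ and is $F_\sigma$ as a subset of $2^{\mathbb{N}}$. Let $\mathcal{I}^+=\mathcal{P}(\mathbb{N})\setminus\mathcal{I}$. Then $\mathbb{S}^+(\mathcal{I}^+)$, with the subspace topology from $I(\mathbb{N})$, is a Polish inverse subsemigroup of $I(\mathbb{N})$ without the Pettis property.
   Context: $I(\mathbb{N})$ is the set of all bijections $f:A\to B$ with $A,B\subseteq\mathbb{N}$ (including the empty function $1_\emptyset$); write $\mathrm{dom}(f)=A$, $\mathrm{im}(f)=B$. The operation is composition of partial functions: $\mathrm{dom}(f\circ g)=g^{-1}(\mathrm{dom}(f)\cap\mathrm{im}(g))$ and $(f\circ g)(x)=f(g(x))$. It is an inverse semigroup, the inverse of $f$ being the inverse function $f^{-1}:B\to A$. The topology $\tau_{pp}$ on $I(\mathbb{N})$ is generated (as a subbase) by the sets $v(x,y)=\{f: x\in\mathrm{dom}(f),\ f(x)=y\}$, $w_1(x)=\{f: x\notin\mathrm{dom}(f)\}$, $w_2(y)=\{f: y\notin\mathrm{im}(f)\}$ for $x,y\in\mathbb{N}$; with it, $I(\mathbb{N})$ is a Polish topological inverse semigroup (composition and inversion are continuous). $I(\mathbb{N})$ always carries $\tau_{pp}$. Subsets of $\mathbb{N}$ are identified with their characteristic functions, so a collection of subsets of $\mathbb{N}$ is a subset of $2^{\mathbb{N}}$ (product topology). For a collection $\mathcal{C}$ of subsets of $\mathbb{N}$, $\mathbb{S}^+(\mathcal{C})=\{h\in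 I(\mathbb{N}): \mathbb{N}\setminus\mathrm{dom}(h)\in\mathcal{C}\text{ and }\mathbb{N}\setminus\mathrm{im}(h)\in\mathcal{C}\}$. An ideal on $\mathbb{N}$ is a collection of subsets of $\mathbb{N}$ that is hereditary (closed under subsets) and closed under finite unions; it is proper if $\mathbb{N}$ does not belong to it. A subset $A$ of a topological space has the Baire property if there is an open set $V$ such that $A\triangle V$ is meager. A topological inverse semigroup $S$ has the Pettis property if for every non-meager $A\subseteq S$ with the Baire property there are an idempotent $e\in S$ and an open set $V\subseteq S$ such that $e\in V$ and $V\subseteq A^{-1}A$, where $A^{-1}A=\{a^{-1}b: a,b\in A\}$ and $a^{-1}$ is the (unique) inverse of $a$ in $S$. *)

(* Defs.v *)
From HB Require Import structures.
From mathcomp Require Import all_boot all_order all_algebra all_fingroup finmap.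
From mathcomp Require Import all_classical all_reals all_analysis.
From mathcomp Require Import borel_hierarchy.

Set Implicit Arguments.
Unset Strict Implicit.
Unset Printing Implicit Defensive.

Local Open Scope classical_set_scope.
Local Open Scope group_scope.

Section Category.
Context {T : topologicalType}.
Implicit Type A : set T.

Definition nowhere_dense A := interior (closure A) = set0.

Definition meager A :=
  exists2 F : (set T)^nat, (forall n, nowhere_dense (F n)) & A = \bigcup_n F n.

Definition baire_property A := exists2 V, open V & meager (A `+` V).

End Category.

Definition homeomorphic (S T : topologicalType) :=
  exists f : S -> T, exists2 g : T -> S,
    cancel f g /\ cancel g f & continuous f /\ continuous g.

Definition separable (T : topologicalType) :=
  exists2 D : set T, countable D & dense D.

(* Not stated with the library's [completeType], which is pointed and would
   exclude the empty space. *)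
Definition complete_metric (R : realType) (M : metricType R) :=
  forall u : M^nat, cauchy (u @ \oo) -> exists l : M, u @ \oo --> l.

Definition polish (R : realType) (T : topologicalType) :=
  separable T /\
  exists2 M : metricType R, complete_metric M & homeomorphic T M.

HB.mixin Record Semigroup_isInverse G of Semigroup G := {
  sinv : G -> G;
  mulg_sinvK : forall x : G, x * sinv x * x = x;
  sinv_mulgK : forall x : G, sinv x * x * sinv x = sinv x;
  sinv_uniq : forall x y : G, x * y * x = x -> y * x * y = y -> y = sinv x
}.

#[short(type="inverseSemigroupType")]
HB.structure Definition InverseSemigroup :=
  {G of Semigroup_isInverse G & Semigroup G}.

HB.mixin Record InverseSemigroup_isTopological G
    of InverseSemigroup G & Topological G := {
  mulg_continuous : continuous (fun xy : G * G => xy.1 * xy.2);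
  sinv_continuous : continuous (@sinv G)
}.

#[short(type="topologicalInverseSemigroupType")]
HB.structure Definition TopologicalInverseSemigroup :=
  {G of InverseSemigroup_isTopological G & InverseSemigroup G & Topological G}.

Definition idempotent_elt (G : magmaType) (e : G) := e * e = e.

Definition pettis_property (G : topologicalInverseSemigroupType) :=
  forall A : set G, ~ meager A -> baire_property A ->
  exists (e : G) (V : set G),
    [/\ idempotent_elt e, open V, V e &
        V `<=` [set sinv a * b | a in A & b in A]].

Record inverseSubsemigroup (G : inverseSemigroupType) := InverseSubsemigroup {
  subsemigroup_set :> set G;
  subsemigroupM : forall x y, subsemigroup_set x -> subsemigroup_set y ->
    subsemigroup_set (x * y);
  subsemigroupV : forall x, subsemigroup_set x -> subsemigroup_set (sinv x)
}.

(* The topology of [set_type] is the subspace topology. *)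
Definition subsemigroup_of (G : inverseSemigroupType)
  (H : inverseSubsemigroup G) : Type := set_type H.

Section SubsemigroupAlgebra.
Context {G : inverseSemigroupType} (H : inverseSubsemigroup G).
Local Notation sT := (subsemigroup_of H).

HB.instance Definition _ := Choice.on sT.

Let sub_mul (x y : sT) : sT :=
  exist _ (set_val x * set_val y)
    (mem_set (subsemigroupM (set_valP x) (set_valP y))).

Let sub_inv (x : sT) : sT :=
  exist _ (sinv (set_val x)) (mem_set (subsemigroupV (set_valP x))).

Let sub_mulA : associative sub_mul.
Proof. by move=> x y z; apply: val_inj; exact: mulgA. Qed.

HB.instance Definition _ := isSemigroup.Build sT sub_mulA.

Let sub_mulVK (x : sT) : x * sub_inv x * x = x.
Proof. by apply: val_inj; exact: mulg_sinvK. Qed.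

Let sub_mulKV (x : sT) : sub_inv x * x * sub_inv x = sub_inv x.
Proof. by apply: val_inj; exact: sinv_mulgK. Qed.

Let sub_inv_uniq (x y : sT) : x * y * x = x -> y * x * y = y -> y = sub_inv x.
Proof.
move=> /(congr1 val) xyx /(congr1 val) yxy.
by apply: val_inj; exact: sinv_uniq.
Qed.

HB.instance Definition _ :=
  Semigroup_isInverse.Build sT sub_mulVK sub_mulKV sub_inv_uniq.

End SubsemigroupAlgebra.

Lemma continuous_set_type {X T : topologicalType} (A : set T) (f : X -> A) :
  continuous (set_val \o f) -> continuous f.
Proof.
move=> cf; apply/continuousP => U [V oV <-].
by move/continuousP: cf => /(_ _ oV).
Qed.

Section SubsemigroupTopology.
Context {G : topologicalInverseSemigroupType} (H : inverseSubsemigroup G).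
Local Notation sT := (subsemigroup_of H).

HB.instance Definition _ := Topological.copy sT (set_type H).

Let inj (x : sT) : G := set_val x.

Let inj_continuous : continuous inj.
Proof. exact: initial_continuous. Qed.

Let sub_mul_continuous : continuous (fun xy : sT * sT => xy.1 * xy.2).
Proof.
apply: (@continuous_set_type (sT * sT)%type G H) => xy.
apply: (@continuous_comp _ (G * G)%type _
  (fun xy : sT * sT => (inj xy.1, inj xy.2)) (fun xy => xy.1 * xy.2)).
  apply: cvg_pair => /=.
    apply: (@continuous_comp _ sT G fst inj); first exact: cvg_fst.
    exact: inj_continuous.
  apply: (@continuous_comp _ sT G snd inj); first exact: cvg_snd.
  exact: inj_continuous.
exact: mulg_continuous.
Qed.

Let sub_inv_continuous : continuous (@sinv sT).
Proof.
apply: (@continuous_set_type sT G H) => x.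
apply: (@continuous_comp sT G G inj (@sinv G)); first exact: inj_continuous.
exact: sinv_continuous.
Qed.

HB.instance Definition _ :=
  InverseSemigroup_isTopological.Build sT sub_mul_continuous sub_inv_continuous.

End SubsemigroupTopology.

(* A bijection f : A -> B with A, B subsets of nat is the same thing as an
   injective partial function on nat, with A its domain and B its image. *)
Record pbij := PBij {
  pbij_fun :> nat -> option nat;
  pbij_inj : forall x1 x2 y,
    pbij_fun x1 = Some y -> pbij_fun x2 = Some y -> x1 = x2
}.

HB.instance Definition _ := gen_eqMixin pbij.
HB.instance Definition _ := gen_choiceMixin pbij.

Definition dom (f : pbij) : set nat := [set x | exists y, f x = Some y].
Definition im (f : pbij) : set nat := [set y | exists x, f x = Some y].

Lemma pbijP (f g : pbij) : (forall x y, f x = Some y <-> g x = Some y) -> f = g.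
Proof.
move=> fg; have {}fg : pbij_fun f = pbij_fun g.
  apply/funext => x; case fx: (f x) => [y|]; first by rewrite (fg x y).1.
  by case gx: (g x) => [y|//]; rewrite (fg x y).2 in fx.
case: f g fg => [f fi] [g gi] /= fg; move: fi; rewrite fg => fi.
by congr PBij; exact: Prop_irrelevance.
Qed.

Definition pcomp_fun (f g : pbij) (x : nat) : option nat := obind f (g x).

Lemma pcomp_funP f g x z :
  pcomp_fun f g x = Some z <-> exists2 y, g x = Some y & f y = Some z.
Proof.
rewrite /pcomp_fun; case: (g x) => [y|] /=; last by split => // -[].
by split=> [fy|[_ [<-]]//]; exists y.
Qed.

Lemma pcomp_inj f g x1 x2 z :
  pcomp_fun f g x1 = Some z -> pcomp_fun f g x2 = Some z -> x1 = x2.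
Proof.
move=> /pcomp_funP[y1 g1 f1] /pcomp_funP[y2 g2 f2].
by move: g1; rewrite (pbij_inj f1 f2) => g1; exact: pbij_inj g1 g2.
Qed.

(* The product f * g is the composition f o g (g is applied first). *)
Definition pcomp f g := PBij (@pcomp_inj f g).

Definition pinv_fun (f : pbij) (y : nat) : option nat :=
  if pselect (im f y) is left fy then Some (projT1 (cid fy)) else None.

Lemma pinv_funP f x y : pinv_fun f y = Some x <-> f x = Some y.
Proof.
rewrite /pinv_fun; case: pselect => [fy|nfy]; last first.
  by split=> // fx; case: nfy; exists x.
case: (cid fy) => x' /= fx'; split=> [[<-]//|fx].
by rewrite (pbij_inj fx fx').
Qed.

Lemma pinv_inj f y1 y2 x :
  pinv_fun f y1 = Some x -> pinv_fun f y2 = Some x -> y1 = y2.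
Proof. by move=> /pinv_funP fx /pinv_funP; rewrite fx => -[]. Qed.

Definition pinv f := PBij (@pinv_inj f).

Lemma pcompA : associative pcomp.
Proof.
move=> f g h; apply: pbijP => x y /=; rewrite /pcomp_fun /= /pcomp_fun.
by case: (h x).
Qed.

HB.instance Definition _ := isSemigroup.Build pbij pcompA.

Lemma pmulP (f g : pbij) x z :
  (f * g) x = Some z <-> exists2 y, g x = Some y & f y = Some z.
Proof. exact: pcomp_funP. Qed.

Lemma pmul_invK (f : pbij) : f * pinv f * f = f.
Proof.
apply: pbijP => x z; rewrite pmulP; split.
  by move=> [y fx /pmulP[x' /pinv_funP fx' fz]]; rewrite fx -fx'.
by move=> fx; exists z => //; apply/pmulP; exists x => //; apply/pinv_funP.
Qed.

Lemma pinv_mulK (f : pbij) : pinv f * f * pinv f = pinv f.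
Proof.
apply: pbijP => y x; rewrite pmulP; split.
  move=> [x' /pinv_funP fx' /pmulP[y' fx'y' /pinv_funP fx]].
  by apply/pinv_funP; rewrite fx -fx'y'.
move=> fx; exists x => //; apply/pmulP; exists y => //.
exact/pinv_funP.
Qed.

Lemma pinv_uniq (f g : pbij) : f * g * f = f -> g * f * g = g -> g = pinv f.
Proof.
move=> fgf gfg; apply: pbijP => y x; split=> [gy|/pinv_funP fx].
  apply/pinv_funP; move: (gy); rewrite -{1}gfg => /pmulP[x'].
  rewrite gy => -[<-] /pmulP[y' fx gy'].
  by rewrite fx (pbij_inj gy' gy).
move: (fx); rewrite -{1}fgf => /pmulP[y']; rewrite fx => -[<-].
by move=> /pmulP[x' gy fx']; rewrite gy (pbij_inj fx' fx).
Qed.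

HB.instance Definition _ :=
  Semigroup_isInverse.Build pbij pmul_invK pinv_mulK pinv_uniq.

Definition vpp (x y : nat) : set pbij := [set f | f x = Some y].
Definition w1pp (x : nat) : set pbij := [set f | ~ dom f x].
Definition w2pp (y : nat) : set pbij := [set f | ~ im f y].

Definition pp_subbase : set (set pbij) :=
  [set vpp xy.1 xy.2 | xy in setT] `|` range w1pp `|` range w2pp.

HB.instance Definition _ := isSubBaseTopological.Build pbij pp_subbase id.

Lemma pp_subbase_open A : pp_subbase A -> open A.
Proof.
move=> sA; exists [set A]; last by rewrite bigcup_set1.
by move=> _ ->; exact: (@finI_from1 _ _ pp_subbase id).
Qed.

Lemma continuous_pp (X : topologicalType) (h : X -> pbij) :
  (forall A, pp_subbase A -> open (h @^-1` A)) -> continuous h.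
Proof.
move=> ho x A; rewrite nbhsE => -[B [oB Bhx] BA].
move: oB Bhx BA => [D DI <-] [C DC Chx] BA.
have CA : C `<=` A by move=> f Cf; apply: BA; exists C.
apply: (@filterS _ _ _ (h @^-1` C)); first by move=> z /CA.
have [E sE EC] := DI _ DC; rewrite -EC in Chx *.
rewrite preimage_bigcap; apply: filter_bigI => F EF.
apply: open_nbhs_nbhs; split; last exact: Chx.
by apply: ho; have := sE _ EF; rewrite inE.
Qed.

Lemma open_vpp x y : open (vpp x y).
Proof. by apply: pp_subbase_open; left; left; exists (x, y). Qed.

Lemma open_w1pp x : open (w1pp x).
Proof. by apply: pp_subbase_open; left; right; exists x. Qed.

Lemma open_w2pp y : open (w2pp y).
Proof. by apply: pp_subbase_open; right; exists y. Qed.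

Lemma pcomp_continuous : continuous (fun fg : pbij * pbij => fg.1 * fg.2).
Proof.
have o1 U : open U -> open [set fg : pbij * pbij | U fg.1].
  by move=> oU; apply: (@open_comp _ _ fst U) => // ? _; exact: cvg_fst.
have o2 U : open U -> open [set fg : pbij * pbij | U fg.2].
  by move=> oU; apply: (@open_comp _ _ snd U) => // ? _; exact: cvg_snd.
apply: continuous_pp => A [[[[x z] _ <-]|[x _ <-]]|[z _ <-]].
- rewrite (_ : _ @^-1` _ =
    \bigcup_y ([set fg | vpp x y fg.2] `&` [set fg | vpp y z fg.1])).
    by apply: bigcup_open => y _; apply: openI;
      [apply: o2|apply: o1]; exact: open_vpp.
  apply/seteqP; split=> -[f g] /=; first by move=> /pmulP[y]; exists y.
  by move=> [y _ [gx fy]]; apply/pmulP; exists y.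
- rewrite (_ : _ @^-1` _ = [set fg | w1pp x fg.2] `|`
    \bigcup_y ([set fg | vpp x y fg.2] `&` [set fg | w1pp y fg.1])).
    apply: openU; first by apply: o2; exact: open_w1pp.
    by apply: bigcup_open => y _; apply: openI;
      [apply: o2; exact: open_vpp|apply: o1; exact: open_w1pp].
  apply/seteqP; split=> -[f g] /=.
    move=> nfg; have [[y gx]|] := pselect (dom g x); last by left.
    right; exists y => //; split => // -[z fy].
    by apply: nfg; exists z; apply/pmulP; exists y.
  move=> [ngx|[y _ [gx nfy]]] [z /pmulP[y' gx' fy']].
    by apply: ngx; exists y'.
  by apply: nfy; exists z; move: gx'; rewrite gx => -[->].
- rewrite (_ : _ @^-1` _ = [set fg | w2pp z fg.1] `|`
    \bigcup_y ([set fg | vpp y z fg.1] `&` [set fg | w2pp y fg.2])).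
    apply: openU; first by apply: o1; exact: open_w2pp.
    by apply: bigcup_open => y _; apply: openI;
      [apply: o1; exact: open_vpp|apply: o2; exact: open_w2pp].
  apply/seteqP; split=> -[f g] /=.
    move=> nfg; have [[y fy]|] := pselect (im f z); last by left.
    right; exists y => //; split => // -[x gx].
    by apply: nfg; exists x; apply/pmulP; exists y.
  move=> [nfz|[y _ [fy ngy]]] [x /pmulP[y' gx' fy']].
    by apply: nfz; exists y'.
  by apply: ngy; exists x; rewrite gx' (pbij_inj fy' fy).
Qed.

Lemma pinv_continuous : continuous pinv.
Proof.
apply: continuous_pp => A [[[[x y] _ <-]|[x _ <-]]|[y _ <-]].
- rewrite (_ : _ @^-1` _ = vpp y x); first exact: open_vpp.
  by apply/seteqP; split=> f /= /pinv_funP.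
- rewrite (_ : _ @^-1` _ = w2pp x); first exact: open_w2pp.
  apply/seteqP; split=> f /= nf [y fy]; apply: nf; exists y.
    exact/pinv_funP.
  exact/pinv_funP.
- rewrite (_ : _ @^-1` _ = w1pp y); first exact: open_w1pp.
  apply/seteqP; split=> f /= nf [x fx]; apply: nf; exists x.
    exact/pinv_funP.
  exact/pinv_funP.
Qed.

HB.instance Definition _ :=
  InverseSemigroup_isTopological.Build pbij pcomp_continuous pinv_continuous.

Definition ideal (I : set (set nat)) :=
  (forall A B, A `<=` B -> I B -> I A) /\ setU_closed I.

(* The image of C under the identification of subsets of nat with their
   characteristic functions. *)
Definition char_set (C : set (set nat)) : set cantor_space :=
  [set chi : cantor_space | C [set n | chi n]].

Definition Splus (C : set (set nat)) : set pbij :=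
  [set h | C (~` dom h) /\ C (~` im h)].

(* Main.v *)
(* S^+(I^+) is a G_delta subset of I(N), because h |-> N \ dom h and
   h |-> N \ im h are continuous and I is F_sigma. Recording an element h
   through h, its inverse, and the first stages at which the complements of its
   domain and image are seen to leave each closed piece of I identifies the
   subspace with a closed subset of a countable power of a countable discrete
   space; it is thus Polish, and a Baire space.

   The Pettis property fails for the set A of those b such that infinitely many
   n satisfy n, n + 1 \notin dom b. Cutting b down to a finite restriction shows
   that A is comeager. If h is in A^-1 A then dom h also misses infinitely many
   pairs {n, n + 1}. As I is a proper ideal, the even numbers or the odd numbers
   form a set Z in I^+; every neighborhood of an idempotent 1_X contains some
   1_Y where Y is X below some k and N \ Z above k, and this 1_Y lies in
   S^+(I^+) while Y meets every pair {n, n + 1} with n >= k. *)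
Require Import Defs.
From HB Require Import structures.
From mathcomp Require Import all_boot all_order all_algebra all_fingroup finmap.
From mathcomp Require Import all_classical all_reals all_analysis.
From mathcomp Require Import borel_hierarchy.

Set Implicit Arguments.
Unset Strict Implicit.
Unset Printing Implicit Defensive.

Import Order.TTheory GRing.Theory Num.Theory.

Local Open Scope classical_set_scope.

(* [dom], [im] and [pinv] are shadowed by later imports. *)
Local Notation dom := Defs.dom.
Local Notation im := Defs.im.
Local Notation pinv := Defs.pinv.

(** * Codings in a countable power of a discrete space, and the metric they induce *)

Definition prefix_cyl {T X : Type} (c : T -> nat -> X) (x : T) (n : nat) :
  set T := [set y | forall i, (i < n)%N -> c y i = c x i].

Section PrefixCyl.
Context {T X : Type} (c : T -> nat -> X).
Local Notation cyl := (prefix_cyl c).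

Lemma prefix_cyl_sub x m n : (m <= n)%N -> cyl x n `<=` cyl x m.
Proof. by move=> mn y xy i im; apply: xy; exact: leq_trans im mn. Qed.

Lemma prefix_cyl_eq x y n : cyl x n y -> cyl y n = cyl x n.
Proof.
by move=> xy; apply/seteqP; split=> z yz i ni; rewrite yz// xy.
Qed.

Lemma prefix_cyl_filter x : Filter (filter_from setT (cyl x)).
Proof.
apply: filter_from_filter; first by exists 0%N.
move=> m n _ _; exists (maxn m n) => // y xy; split.
  exact: prefix_cyl_sub (leq_maxl _ _) _ xy.
exact: prefix_cyl_sub (leq_maxr _ _) _ xy.
Qed.

End PrefixCyl.

(* A coding of [T] as a closed subspace of the product of countably many copies
   of the discrete space [X]. *)
Record baire_coding (T : topologicalType) (X : Type) (c : T -> nat -> X) :=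
  BaireCoding {
    coding_inj : injective c;
    coding_nbhs : forall x, nbhs x = filter_from setT (prefix_cyl c x);
    coding_closed : forall a : nat -> X,
      (forall n, exists x, forall i, (i < n)%N -> c x i = a i) ->
      exists x, c x = a
  }.

(** A copy of [T] whose type also carries [R], [c] and the injectivity proof, so that the metric
    structure can be attached to it. *)
Definition first_diff_metric (R : realType) (T : Type) (X : eqType)
  (c : T -> nat -> X) (c_inj : injective c) : Type := T.

Section FirstDiffMetric.
Context (R : realType) (T : choiceType) (X : eqType) (c : T -> nat -> X).
Context (c_inj : injective c).
Local Notation M := (first_diff_metric R c_inj).
Local Open Scope ring_scope.

Definition first_diff_dist (x y : T) : R :=
  if pselect (exists n, c x n != c y n) is left xy
  then (ex_minn xy).+1%:R^-1 else 0.
Local Notation d := first_diff_dist.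

Lemma first_diff_dist_ge0 x y : 0 <= d x y.
Proof. by rewrite /d; case: pselect => // ?; rewrite invr_ge0. Qed.

Lemma first_diff_distP x y n :
  d x y < n.+1%:R^-1 <-> prefix_cyl c x n.+1 y.
Proof.
rewrite /d; case: pselect => [xy|nxy]; last first.
  split=> [_ i _|_]; last by rewrite invr_gt0.
  by apply/eqP/negPn/negP; rewrite eq_sym => cxy; apply: nxy; exists i.
case: ex_minnP => m cxym m_min; rewrite ltf_pV2 ?posrE// ltr_nat ltnS; split.
  move=> nm i; rewrite ltnS => /leq_ltn_trans/(_ nm) im.
  apply/eqP/negPn/negP; rewrite eq_sym => /m_min.
  by rewrite leqNgt im.
by move=> cyl; rewrite ltnNge; apply: contra cxym => mn; rewrite cyl.
Qed.

Lemma first_diff_distxx x : d x x = 0.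
Proof.
by rewrite /d; case: pselect => // xx; exfalso; case: xx => n; rewrite eqxx.
Qed.

Lemma first_diff_dist_eq0 x y : d x y = 0 -> x = y.
Proof.
move=> dxy; apply: c_inj; apply/funext => n.
by rewrite ((first_diff_distP x y n).1 _ n)// dxy invr_gt0.
Qed.

Lemma first_diff_dist_sym x y : d x y = d y x.
Proof.
have H u v n : d u v < n.+1%:R^-1 -> d v u < n.+1%:R^-1.
  by move=> /first_diff_distP uv; apply/first_diff_distP => i /uv.
suff le u v : d v u <= d u v by apply/eqP; rewrite eq_le !le.
rewrite leNgt; apply/negP; rewrite {2}/d; case: pselect => [vu|_].
  move=> /H; rewrite /d; case: pselect => // vu'.
  by rewrite (Prop_irrelevance vu vu') ltxx.
by rewrite ltNge first_diff_dist_ge0.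
Qed.

(** If the sum were smaller than [d x z], both of its terms would be, and all three codes would
    agree at the first index where those of [x] and [z] differ. *)
Lemma first_diff_dist_triangle y x z : d x z <= d x y + d y z.
Proof.
rewrite {1}/d; case: pselect => [xz|_]; last first.
  by rewrite addr_ge0// first_diff_dist_ge0.
case: ex_minnP => m cxz _; rewrite leNgt; apply: contra cxz => dm.
have /first_diff_distP-/(_ m) <-// : d x y < m.+1%:R^-1.
  by apply: le_lt_trans dm; rewrite lerDl first_diff_dist_ge0.
have /first_diff_distP-/(_ m) <-// : d y z < m.+1%:R^-1.
by apply: le_lt_trans dm; rewrite lerDr first_diff_dist_ge0.
Qed.

HB.instance Definition _ := Choice.copy M T.
HB.instance Definition _ := @isMetric.Build R M d first_diff_distxx
  first_diff_dist_eq0 first_diff_dist_sym first_diff_dist_triangle.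

Lemma first_diff_nbhs (x : M) : nbhs x = filter_from setT (prefix_cyl c x).
Proof.
apply/seteqP; split=> U.
  rewrite -nbhs_ballE => -[e /= e0 eU].
  have [n _ /(_ _ (leqnn _)) ne] := near_infty_natSinv_lt (PosNum e0).
  exists n.+1 => // y xy; apply: eU; rewrite ballEmdist/=.
  by apply: lt_trans ne; exact/first_diff_distP.
move=> [n _ nU]; rewrite -nbhs_ballE; exists n.+1%:R^-1 => /=.
  by rewrite invr_gt0.
move=> y; rewrite ballEmdist/= => /first_diff_distP xy; apply: nU.
exact: prefix_cyl_sub xy.
Qed.

End FirstDiffMetric.

(** * Completeness, separability and Baire category from a coding *)

Section BaireCoding.
Context (T : topologicalType).

Lemma coding_homeomorphic (R : realType) (X : eqType) (c : T -> nat -> X)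
    (cc : baire_coding c) :
  homeomorphic T (first_diff_metric R (coding_inj cc)).
Proof.
by exists id, id; split=> // x U; rewrite first_diff_nbhs (coding_nbhs cc).
Qed.

Lemma coding_complete (R : realType) (X : eqType) (c : T -> nat -> X)
    (cc : baire_coding c) :
  complete_metric (first_diff_metric R (coding_inj cc)).
Proof.
move=> u /cauchy_ballP cu.
have {}cu n : exists N, forall i j, (N <= i)%N -> (N <= j)%N ->
    prefix_cyl c (u i) n.+1 (u j).
  have n0 : (0 < n.+1%:R^-1 :> R)%R by rewrite invr_gt0.
  have [[A B] /= [[N1 _ AN] [N2 _ BN]] AB] := cu _ n0.
  exists (maxn N1 N2) => i j.
  rewrite !geq_max => /andP[i1 i2] /andP[j1 j2].
  by have := AB (u i, u j) (conj (AN _ i1) (BN _ j2));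
    rewrite /= ballEmdist /= => /first_diff_distP.
have [N NP] := choice cu.
(* From stage [N n] on, coordinate [n] no longer changes, so the limit code is read off
   diagonally. *)
pose a n := c (u (N n)) n.
have ua n k : (forall i, (i < n)%N -> (N i <= k)%N) ->
    forall i, (i < n)%N -> c (u k) i = a i.
  by move=> Nk i ni; apply: NP => //; exact: Nk.
have [l la] : exists l, c l = a.
  apply: (coding_closed cc) => n; exists (u (\max_(i < n) N i)).
  apply: ua => i ni.
  exact: (leq_bigmax (Ordinal ni)).
exists l => U; rewrite first_diff_nbhs => -[n _ nU].
exists (\max_(i < n) N i) => // k /= nk; apply: nU => i ni; rewrite la.
apply: (ua n) => // j nj.
by apply: leq_trans nk; exact: (leq_bigmax (Ordinal nj)).
Qed.

(** One point is chosen for each finite word that begins a code; as [X] is countable, so is the set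
    of words. *)
Lemma coding_separable (X : countType) (c : T -> nat -> X) :
  baire_coding c -> separable T.
Proof.
move=> cc.
pose pick (w : seq X) : option T :=
  if pselect (exists x, mkseq (c x) (size w) = w) is left wx
  then Some (projT1 (cid wx)) else None.
exists (\bigcup_w [set x | pick w = Some x]).
  apply: bigcup_countable => // w _; apply: finite_set_countable.
  case: (pick w) => [y|]; last exact: (@sub_finite_set _ _ set0).
  by apply: (@sub_finite_set _ _ [set y]) => // x [].
move=> O [x Ox] oO.
have : nbhs x O by exact: open_nbhs_nbhs.
rewrite (coding_nbhs cc) => -[n _ nO].
have : exists y, pick (mkseq (c x) n) = Some y /\ prefix_cyl c x n y.
  rewrite /pick; case: pselect => [xy|]; last first.
    by case; exists x; rewrite size_mkseq.
  case: (cid xy) => y /= /(congr1 (fun w i => nth (c x 0%N) w i)) yx.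
  exists y; split=> // i ni; have := congr1 (@^~ i) yx.
  by rewrite /= size_mkseq !nth_mkseq.
by move=> [y [py xy]]; exists y; split; [exact: nO|exists (mkseq (c x) n)].
Qed.

Lemma coding_polish (R : realType) (X : countType) (c : T -> nat -> X) :
  baire_coding c -> polish R T.
Proof.
move=> cc; split; first exact: coding_separable cc.
exists (first_diff_metric R (coding_inj cc)).
  exact: coding_complete.
exact: coding_homeomorphic.
Qed.

(** Baire's argument: nested cylinders avoid the sets [F n] in turn, and closedness of the range of
    the coding yields a point common to all of them. *)
Lemma coding_not_meager (X : Type) (c : T -> nat -> X) :
  baire_coding c -> T -> ~ meager [set: T].
Proof.
move=> cc x0 [F ndF TF].
have step (p : nat * (T * nat)) : exists q : T * nat, [/\ (p.2.2 < q.2)%N,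
    prefix_cyl c p.2.1 p.2.2 q.1 & prefix_cyl c q.1 q.2 `<=` ~` F p.1].
  case: p => n [x k] /=; apply: contrapT => H.
  suff : interior (closure (F n)) x by rewrite ndF.
  rewrite /interior (coding_nbhs cc); exists k => // y xy.
  apply: contrapT => Fy; apply: H.
  have : nbhs y (~` closure (F n)).
    apply: open_nbhs_nbhs; split=> //.
    by apply: closed_openC; exact: closed_closure.
  rewrite (coding_nbhs cc) => -[l _ lF].
  (* The bound [k.+1] makes the lengths grow strictly, so that the cylinders determine every
     coordinate in the end. *)
  exists (y, maxn k.+1 l); split=> //=; first exact: leq_maxl.
  move=> z yz Fz; apply: (lF z _ (subset_closure Fz)).
  exact: prefix_cyl_sub (leq_maxr _ _) _ yz.
have [f fP] := choice step.
pose s := fix s n := if n is m.+1 then f (m, s m) else (x0, 0%N).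
have s_lt n : (n <= (s n).2)%N.
  by elim: n => // n ih; apply: leq_ltn_trans ih _; case: (fP (n, s n)).
have s_cyl n m : (n <= m)%N ->
    prefix_cyl c (s n).1 (s n).2 (s m).1 /\ ((s n).2 <= (s m).2)%N.
  elim: m => [|m ih]; first by rewrite leqn0 => /eqP ->.
  rewrite leq_eqVlt => /predU1P[->//|]; rewrite ltnS => /ih[nm le].
  have [lt cyl _] := fP (m, s m).
  split; last exact: leq_trans le (ltnW lt).
  by rewrite -(prefix_cyl_eq nm); exact: prefix_cyl_sub le _ cyl.
(* The cylinder at stage [i.+1] has length above [i], so coordinate [i] is settled there. *)
pose a i := c (s i.+1).1 i.
have sa n i : (i < (s n).2)%N -> c (s n).1 i = a i.
  move=> ni; rewrite /a; have [le|lt] := leqP n i.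
    by have [->] := s_cyl _ _ (leqW le).
  by have [->] := s_cyl _ _ lt; last exact: s_lt.
have [l la] : exists l, c l = a.
  apply: (coding_closed cc) => n; exists (s n).1 => i ni.
  by apply: sa; exact: leq_trans ni (s_lt n).
have : [set: T] l by [].
rewrite TF => -[n _]; have [_ _] := fP (n, s n); apply.
by move=> i /= ni; rewrite la -(sa n.+1).
Qed.

End BaireCoding.

(** * Exit times from closed subsets of the Cantor space *)

Local Notation bits := (fun x : cantor_space => x : nat -> bool).

Section CantorExit.
Implicit Types (F : set cantor_space) (x y : cantor_space).
Local Notation cyl := (prefix_cyl bits).

(** Otherwise [F] would contain, for each [n], a point agreeing with [x] below [n], and these points
    converge to [x]. *)
Lemma closed_prefix F x : closed F -> ~ F x -> exists n, cyl x n `<=` ~` F.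
Proof.
move=> cF nFx; apply: contrapT => nF; apply: nFx.
have /choice[u uP] : forall n, exists y, cyl x n y /\ F y.
  move=> n; apply: contrapT => ny; apply: nF; exists n => y xy Fy.
  by apply: ny; exists y.
apply: (@closed_cvg _ _ \oo _ u F cF _ x).
  by apply: nearW => n; have [] := uP n.
apply/cvg_sup => i; apply/cvg_image.
  by apply/seteqP; split => // b _; exists (fun=> b).
move=> U /= Ub; exists [set y : cantor_space | U (y i)].
  exists i.+1 => // n /= ni; have [/(_ i ni) -> _] := uP n.
  exact: nbhs_singleton.
by apply/seteqP; split => [b [y Uy <-]//|b Ub']; exists (fun=> b).
Qed.

(** For closed [F], the default [0] is reached only when [x] lies in [F]. *)
Definition exit_time F x : nat :=
  if pselect (exists n, `[< cyl x n `<=` ~` F >]) is left xF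
  then ex_minn xF else 0%N.

Lemma exit_timeP F x : closed F -> ~ F x -> cyl x (exit_time F x) `<=` ~` F.
Proof.
move=> cF nFx; rewrite /exit_time; case: pselect => [xF|]; last first.
  by have [n nF] := closed_prefix cF nFx; case; exists n; apply/asboolP.
by case: ex_minnP => n /asboolP.
Qed.

Lemma exit_time_min F x n : cyl x n `<=` ~` F -> (exit_time F x <= n)%N.
Proof.
move=> nF; rewrite /exit_time; case: pselect => [xF|_]; last exact: leq0n.
by case: ex_minnP => m _; apply; apply/asboolP.
Qed.

(** Up to that length the cylinders of [x] and [y] coincide, so both minima are the same. Exit times
    are thus locally constant off [F], which makes them admissible as coordinates of a coding. *)
Lemma exit_time_prefix F x y : closed F -> ~ F x ->
  cyl x (exit_time F x) y -> exit_time F y = exit_time F x.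
Proof.
move=> cF nFx xy; apply/eqP; rewrite eqn_leq.
have yx : (exit_time F y <= exit_time F x)%N.
  by apply: exit_time_min; rewrite (prefix_cyl_eq xy); exact: exit_timeP.
rewrite yx; apply: exit_time_min.
rewrite -(prefix_cyl_eq (prefix_cyl_sub yx xy)); apply: exit_timeP => //.
exact: exit_timeP xy.
Qed.

End CantorExit.

(** * The topology of $I(\mathbb{N})$ through finite prefixes *)

Definition pp_code (h : pbij) (n : nat) : option nat * option nat :=
  (h n, pinv h n).

(** The value of [h] at [x] decides [vpp x y] and [w1pp x], that of the inverse at [y] decides
    [w2pp y]. The inverse is coded as well because finitely many values of [h] cannot show that [y]
    is missed by the image. *)
Lemma pp_nbhs (h : pbij) : nbhs h = filter_from setT (prefix_cyl pp_code h).
Proof.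
have ff := @prefix_cyl_filter _ _ pp_code h.
apply/seteqP; split=> U.
  rewrite nbhsE => -[B [oB Bh] BU]; apply: filterS BU _.
  move: oB Bh => [D DI <-] [C DC Ch].
  apply: (@filterS _ _ _ C); first by move=> f Cf; exists C.
  have [E sE EC] := DI _ DC; rewrite -EC in Ch *.
  apply: filter_bigI => F EF; have := sE _ EF; rewrite inE.
  have {}Ch := Ch _ EF.
  case=> [[[[x y] _ xyF]|[x _ xF]]|[y _ yF]].
  - exists x.+1 => // f /(_ x (ltnSn x)) [fx _].
    by move: Ch; rewrite -xyF => hx; exact: etrans fx hx.
  - exists x.+1 => // f /(_ x (ltnSn x)) [fx _].
    move: Ch; rewrite -xF => hx [y fxy]; apply: hx.
    by exists y; rewrite -fxy fx.
  - exists y.+1 => // f /(_ y (ltnSn y)) [_ fy].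
    move: Ch; rewrite /= -yF => hy [x /pinv_funP fx]; apply: hy; exists x.
    by apply/pinv_funP; rewrite -fx -fy.
move=> [n _ nU]; apply: filterS nU _.
elim: n => [|n ih]; first by apply: filterS filterT.
(* A value [Some] is fixed by a set [vpp], a value [None] by [w1pp] or, for the inverse, by
   [w2pp]. *)
have : nbhs h [set g : pbij | g n = h n /\ pinv g n = pinv h n].
  apply: filterI.
    case hn : (h n) => [y|].
      by apply: open_nbhs_nbhs; split => //; exact: open_vpp.
    have : nbhs h (w1pp n).
      apply: open_nbhs_nbhs; split; first exact: open_w1pp.
      by move=> [y]; rewrite hn.
    by apply: filterS => g /= gn; case gny: (g n) => [y|//]; case: gn; exists y.
  case hn : (pinv h n) => [y|].
    have : nbhs h (vpp y n).
      apply: open_nbhs_nbhs; split; first exact: open_vpp.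
      by rewrite /vpp /=; apply/pinv_funP.
    by apply: filterS => g /= gn; exact/pinv_funP.
  have : nbhs h (w2pp n).
    apply: open_nbhs_nbhs; split; first exact: open_w2pp.
    by move=> [y /pinv_funP e]; move: hn; rewrite /= e.
  apply: filterS => g /= gn; case gny: (pinv_fun g n) => [y|//]; case: gn.
  by exists y; apply/pinv_funP.
apply: filterS2 ih => g ghn [gn vgn] i; rewrite ltnS leq_eqVlt.
by case/predU1P => [->|/ghn//]; rewrite /pp_code gn vgn.
Qed.

Lemma nbhs_set_type (T : topologicalType) (A : set T) (x : A) (U : set A) :
  nbhs x U <-> exists2 V, nbhs (set_val x) V & set_val @^-1` V `<=` U.
Proof.
split=> [[_ [[V oV <-] Vx] VU]|[V xV VU]]; last first.
  by apply: filterS VU _; exact: (@initial_continuous A T set_val x V xV).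
exists V; last exact: VU.
by apply: open_nbhs_nbhs; split.
Qed.

(** Applied to [pinv h], it describes the complement of the image of [h]. *)
Definition domC_char (h : pbij) : cantor_space := fun n => h n == None.

Lemma char_set_domC (I : set (set nat)) (h : pbij) :
  char_set I (domC_char h) = I (~` dom h).
Proof.
congr I; apply/seteqP; split=> n /=; rewrite /domC_char.
  by move=> /eqP hn [y]; rewrite hn.
by move=> nh; case hn: (h n) => [y|//]; case: nh; exists y.
Qed.

Lemma dom_pinv (h : pbij) : dom (pinv h) = im h.
Proof. by apply/seteqP; split=> y [x /pinv_funP hx]; exists x. Qed.

Lemma im_pinv (h : pbij) : im (pinv h) = dom h.
Proof. by apply/seteqP; split=> y [x /pinv_funP hx]; exists x. Qed.

(** * Coding of a $G_\delta$ set of partial bijections *)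

Section GdeltaCoding.
Variables (F : nat -> set cantor_space) (A : set pbij).
Hypothesis closedF : forall n, closed (F n).
Hypothesis AP : forall h, A h <->
  forall n, ~ F n (domC_char h) /\ ~ F n (domC_char (pinv h)).

Local Notation exit1 n h := (exit_time (F n) (domC_char h)).
Local Notation exit2 n h := (exit_time (F n) (domC_char (pinv h))).

(* The exit times record at which finite stage the complements of the domain
   and of the image are seen to avoid [F n]; they make the range closed. *)
Definition gdelta_code (x : A) (n : nat) :
    (option nat * option nat) * (nat * nat) :=
  let h : pbij := set_val x in (pp_code h n, (exit1 n h, exit2 n h)).

Let domC_char_cyl h g n : prefix_cyl pp_code h n g ->
  prefix_cyl bits (domC_char h) n (domC_char g) /\
  prefix_cyl bits (domC_char (pinv h)) n (domC_char (pinv g)).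
Proof.
by move=> hg; split=> i /hg[gh pgh]; rewrite /domC_char ?gh//= pgh.
Qed.

Let mem_A (x : A) n :
  ~ F n (domC_char (set_val x)) /\ ~ F n (domC_char (pinv (set_val x))).
Proof. exact: (AP _).1 (set_valP x) n. Qed.

Lemma gdelta_code_inj : injective gdelta_code.
Proof.
move=> x y xy; apply: val_inj; apply: pbijP => i z.
by have [->] := congr1 (@^~ i) xy.
Qed.

Lemma gdelta_code_nbhs x : nbhs x = filter_from setT (prefix_cyl gdelta_code x).
Proof.
apply/seteqP; split=> U.
  move=> /nbhs_set_type[V]; rewrite pp_nbhs => -[n _ nV] VU.
  exists n => // y xy.
  by apply: VU; apply: nV => i /xy [gh pgh _ _]; rewrite /pp_code gh/= pgh.
move=> [n _ nU]; apply/nbhs_set_type.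
(* A prefix of this length fixes the values at [i] and, by local constancy, both exit times for
   [F i]. *)
pose k i := maxn i.+1 (maxn (exit1 i (set_val x)) (exit2 i (set_val x))).
exists (prefix_cyl pp_code (set_val x) (\max_(i < n) k i)).
  by rewrite pp_nbhs; exists (\max_(i < n) k i).
move=> y xy; apply: nU => i ni.
have le : (k i <= \max_(i < n) k i)%N by exact: (leq_bigmax (Ordinal ni)).
have {xy le} xy := prefix_cyl_sub le xy.
have [F1 F2] := mem_A x i.
rewrite /gdelta_code xy; last exact: leq_maxl.
have [xy1 xy2] := domC_char_cyl xy.
congr (_, (_, _)); apply: exit_time_prefix => //.
  by apply: prefix_cyl_sub xy1; rewrite /k !leq_max leqnn orbT.
by apply: prefix_cyl_sub xy2; rewrite /k !leq_max leqnn !orbT.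
Qed.

(** The values in [a] define a partial bijection [h]; the exit times in [a] are finite bounds
    certifying that [h] stays outside every [F n], hence in [A]. *)
Lemma gdelta_code_closed (a : nat -> (option nat * option nat) * (nat * nat)) :
  (forall n, exists x, forall i, (i < n)%N -> gdelta_code x i = a i) ->
  exists x, gdelta_code x = a.
Proof.
move=> /choice[u ua].
have upp n i : (i < n)%N -> pp_code (set_val (u n)) i = (a i).1.
  by move=> /ua <-.
(* Both coordinates involved already occur in the code of a single [u n], where the two maps are
   mutually inverse. *)
have a_inv x y : (a x).1.1 = Some y <-> (a y).1.2 = Some x.
  rewrite -(upp (maxn x y).+1 x (leq_maxl _ _)).
  by rewrite -(upp (maxn x y).+1 y (leq_maxr _ _)); split=> /pinv_funP.
have a_inj x1 x2 y : (a x1).1.1 = Some y -> (a x2).1.1 = Some y -> x1 = x2.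
  by move=> /a_inv e1 /a_inv; rewrite e1 => -[].
pose h := PBij a_inj.
have pinv_h y : pinv h y = (a y).1.2.
  rewrite /=; case e : (pinv_fun h y) => [x|]; first by move/pinv_funP/a_inv: e.
  by case e' : (a y).1.2 => [x|//]; move/a_inv/(pinv_funP h): e'; rewrite e.
have hpp i : pp_code h i = (a i).1.
  by rewrite /pp_code pinv_h -surjective_pairing.
have uh n : prefix_cyl pp_code (set_val (u n)) n h.
  by move=> i ni; rewrite hpp upp.
(* The index [k] is past coordinate [n] and past the exit times stored in [a n], so [h] agrees with
   [u k] for long enough to leave [F n] with it. *)
have exits n : let k := maxn n.+1 (maxn (a n).2.1 (a n).2.2) in
    [/\ a n = gdelta_code (u k) n,
     prefix_cyl bits (domC_char (set_val (u k))) (exit1 n (set_val (u k)))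
       (domC_char h) &
     prefix_cyl bits (domC_char (pinv (set_val (u k))))
       (exit2 n (set_val (u k))) (domC_char (pinv h))].
  move=> k; have uk : gdelta_code (u k) n = a n by apply: ua; exact: leq_maxl.
  have [e1 e2] : (a n).2.1 = exit1 n (set_val (u k)) /\
      (a n).2.2 = exit2 n (set_val (u k)) by rewrite -uk.
  have [h1 h2] := domC_char_cyl (uh k); split=> //.
    by apply: prefix_cyl_sub h1; rewrite -e1 /k !leq_max leqnn orbT.
  by apply: prefix_cyl_sub h2; rewrite -e2 /k !leq_max leqnn !orbT.
have Ah : A h.
  apply/AP => n; have [_ h1 h2] := exits n.
  have [F1 F2] := mem_A (u (maxn n.+1 (maxn (a n).2.1 (a n).2.2))) n.
  by split; [exact: exit_timeP h1|exact: exit_timeP h2].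
exists (exist _ h (mem_set Ah)); apply/funext => n.
have [an h1 h2] := exits n; apply: etrans (esym an).
have [F1 F2] := mem_A (u (maxn n.+1 (maxn (a n).2.1 (a n).2.2))) n.
transitivity (pp_code h n, (exit1 n h, exit2 n h)); first by [].
rewrite (exit_time_prefix _ _ h1)// (exit_time_prefix _ _ h2)//.
by congr (_, _); apply: uh; exact: leq_maxl.
Qed.

Lemma gdelta_coding : baire_coding gdelta_code.
Proof.
split; [exact: gdelta_code_inj|exact: gdelta_code_nbhs|].
exact: gdelta_code_closed.
Qed.

End GdeltaCoding.

(** * Meager sets *)

Lemma nowhere_denseC (T : topologicalType) (A : set T) :
  open A -> dense A -> nowhere_dense (~` A).
Proof.
move=> oA dA; rewrite /nowhere_dense.
have /closure_id <- : closed (~` A) by exact: open_closedC.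
rewrite -subset0 => x xA.
have [y [yA Ay]] := dA _ (ex_intro _ x xA) (@open_interior _ _).
by have := interior_subset yA; apply.
Qed.

Lemma meagerU (T : topologicalType) (A B : set T) :
  meager A -> meager B -> meager (A `|` B).
Proof.
move=> [F ndF ->] [G ndG ->].
exists (fun n => if odd n then F n./2 else G n./2).
  by move=> n; case: ifP.
apply/seteqP; split=> x.
  move=> [[n _ Fx]|[n _ Gx]].
    by exists n.*2.+1 => //; rewrite /= odd_double /= uphalf_double.
  by exists n.*2 => //; rewrite odd_double doubleK.
by move=> [n _]; case: ifP => _ ?; [left|right]; exists n./2.
Qed.

Lemma meager_setC_bigcap (T : topologicalType) (A : (set T)^nat) :
  (forall n, open (A n)) -> (forall n, dense (A n)) ->
  meager (~` \bigcap_n A n).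
Proof.
move=> oA dA; exists (fun n => ~` A n); last exact: setC_bigcap.
by move=> n; exact: nowhere_denseC.
Qed.

(** * Partial identities as the idempotents of $I(\mathbb{N})$ *)

Definition pid (D : set nat) : pbij.
Proof.
exists (fun n => if n \in D then Some n else None).
by move=> x1 x2 y; case: ifP => // _ [->]; case: ifP => // _ [].
Defined.

Lemma pidP D x y : pid D x = Some y <-> x = y /\ D x.
Proof.
rewrite /=; case: ifPn => [/set_mem Dx|/negP nDx]; split=> //; last first.
  by move=> [_ /mem_set].
  by move=> [->].
by move=> [].
Qed.

Lemma dom_pid D : dom (pid D) = D.
Proof.
apply/seteqP; split=> x; first by move=> [y /pidP[]].
by move=> Dx; exists x; apply/pidP.
Qed.

Lemma im_pid D : im (pid D) = D.
Proof.
apply/seteqP; split=> y; first by move=> [x /pidP[<-]].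
by move=> Dy; exists y; apply/pidP.
Qed.

Lemma pinv_pid D : pinv (pid D) = pid D.
Proof.
by apply: pbijP => x y; split=> [/pinv_funP/pidP|/pidP] [-> Dy];
  [apply/pidP|apply/pinv_funP/pidP].
Qed.

(** If $e(x)=y$, idempotence gives $e(y)=y$, and injectivity then forces $x=y$. *)
Lemma idempotent_pid (e : pbij) : (e * e)%g = e -> e = pid (dom e).
Proof.
move=> ee; apply: pbijP => x y; rewrite pidP; split=> [exy|[<- [z exz]]].
  have : dom e x by exists y.
  split=> //; move: (exy); rewrite -{1}ee => /pmulP[y'].
  rewrite exy => -[<-] eyy.
  exact: pbij_inj exy eyy.
move: (exz); rewrite -{1}ee => /pmulP[z']; rewrite exz => -[<-] ezz.
by rewrite {1}(pbij_inj exz ezz).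
Qed.

(** The code of a partial identity at [i] depends only on whether [i] is in its domain, so a
    neighborhood constrains [D] only below some [n]. *)
Lemma pid_near (e : pbij) (U : set pbij) : (e * e)%g = e -> nbhs e U ->
  exists n, forall D : set nat,
    (forall i, (i < n)%N -> D i <-> dom e i) -> U (pid D).
Proof.
move=> ee; rewrite pp_nbhs => -[n _ nU]; exists n => D De; apply: nU => i ni.
rewrite /pp_code pinv_pid (idempotent_pid ee) pinv_pid /=.
suff -> : (i \in D) = (i \in dom e) by [].
by apply/idP/idP; rewrite !in_setE => /(De _ ni).
Qed.

(** * The inverse subsemigroup $\mathbb{S}^+(\mathcal{I}^+)$ *)

Section SplusSubsemigroup.
Variable I : set (set nat).
Hypothesis I_sub : forall A B : set nat, A `<=` B -> I B -> I A.
Local Notation S := (Splus (~` I)).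

(** Restriction enlarges the complements of domain and image, and $\mathcal{I}^+$ is closed under
    supersets. *)
Lemma Splus_restrict (g h : pbij) :
  (forall x y, g x = Some y -> h x = Some y) -> S h -> S g.
Proof.
move=> gh [Sd Si]; split.
  by apply: contra_not Sd; apply: I_sub; apply: subsetC => x [y /gh]; exists y.
by apply: contra_not Si; apply: I_sub; apply: subsetC => y [x /gh]; exists x.
Qed.

Lemma SplusM (g h : pbij) : S g -> S h -> S (g * h)%g.
Proof.
move=> [_ Sg] [Sh _]; split.
  apply: contra_not Sh; apply: I_sub; apply: subsetC => x [z /pmulP[y hx _]].
  by exists y.
apply: contra_not Sg; apply: I_sub; apply: subsetC => z [x /pmulP[y _ gy]].
by exists y.
Qed.

Lemma SplusV (h : pbij) : S h -> S (pinv h).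
Proof. by move=> [Sd Si]; split; rewrite /= ?dom_pinv ?im_pinv. Qed.

Definition Splus_subsemigroup : inverseSubsemigroup pbij :=
  @InverseSubsemigroup pbij S SplusM SplusV.

End SplusSubsemigroup.

(** * Failure of the Pettis property *)

Section NotPettis.
Variable I : set (set nat).
Hypothesis I_sub : forall A B : set nat, A `<=` B -> I B -> I A.
Hypothesis I_U : setU_closed I.
Hypothesis I_proper : ~ I [set: nat].
Hypothesis I_fin : forall A : set nat, finite_set A -> I A.
Local Notation S := (Splus_subsemigroup I_sub).
Local Notation sT := (subsemigroup_of S).

(** The intersection over [m] consists of the elements whose domain misses infinitely many pairs
    $\{n,n+1\}$. *)
Definition skips_pair_after (m : nat) : set sT :=
  [set b | exists n, [/\ (m <= n)%N, (set_val b : pbij) n = None &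
    (set_val b : pbij) n.+1 = None]].

Lemma open_skips_pair_after m : open (skips_pair_after m).
Proof.
exists (\bigcup_(n in [set n | (m <= n)%N]) (w1pp n `&` w1pp n.+1)).
  by apply: bigcup_open => n _; apply: openI; exact: open_w1pp.
have noneP (h : pbij) n : w1pp n h <-> h n = None.
  split=> [nh|hn [y]]; last by rewrite hn.
  by case hn: (h n) => [y|//]; case: nh; exists y.
by apply/seteqP; split=> b [n]; [move=> mn [/noneP ? /noneP ?]|
  move=> [mn /noneP ? /noneP ?]]; exists n.
Qed.

Lemma dense_skips_pair_after m : dense (skips_pair_after m).
Proof.
move=> O [x Ox] oO.
have /nbhs_set_type[V] : nbhs x O by exact: open_nbhs_nbhs.
rewrite pp_nbhs => -[n _ nV] VO; pose h : pbij := set_val x.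
(* Below [N] lie all [i < n] and all preimages of such [i], so restricting [h] to arguments below
   [N] keeps its code up to [n]. The default [0] stands for a missing preimage and is harmless. *)
pose N := maxn n (\max_(i < n) (odflt 0%N (pinv h i)).+1).
pose g : pbij := (h * pid [set i | (i < N)%N])%g.
have gP i y : g i = Some y <-> h i = Some y /\ (i < N)%N.
  rewrite /g pmulP; split=> [[j /pidP[<-]]//|[hi iN]].
  by exists i => //; apply/pidP.
have Sg : Splus (~` I) g.
  by apply: (Splus_restrict I_sub _ (set_valP x)) => i y /gP[].
exists (exist _ g (mem_set Sg)); split.
  apply: VO; apply: nV => i ni /=; rewrite /pp_code.
  have iN : (i < N)%N by rewrite leq_max ni.
  congr (_, _).
    case hi : (h i) => [y|]; first exact/gP.
    by case gi : (g i) => [y|//]; move/gP: gi; rewrite hi => -[].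
  case hi : (pinv h i) => [y|].
    apply/pinv_funP/gP; split; first exact/pinv_funP.
    rewrite leq_max; apply/orP; right.
    by apply: leq_trans (leq_bigmax (Ordinal ni)); rewrite hi.
  case gi : (pinv g i) => [y|//]; move/pinv_funP/gP: gi => [/pinv_funP].
  by move: hi => /= ->.
have gN i : (N <= i)%N -> g i = None.
  move=> Ni; case gi : (g i) => [y|//]; move/gP: gi.
  by rewrite ltnNge Ni => -[].
by exists (maxn m N); split; rewrite ?leq_maxl// gN// ?leqW// leq_maxr.
Qed.

Lemma not_ideal_parity : exists b, ~ I [set n | odd n = b].
Proof.
apply: contrapT => nb; apply: I_proper.
have Ib b : I [set n | odd n = b] by apply: contrapT => nI; apply: nb; exists b.
apply: I_sub (I_U (Ib true) (Ib false)) => n _ /=.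
by case: (odd n); [left|right].
Qed.

Lemma Splus_not_pettis : ~ meager [set: sT] -> ~ pettis_property sT.
Proof.
move=> nm pettis; pose A := \bigcap_m skips_pair_after m.
have mA : meager (~` A).
  apply: meager_setC_bigcap; first exact: open_skips_pair_after.
  exact: dense_skips_pair_after.
(* [A] is comeager: it is not meager because the whole space is not, and it differs from the open
   set [setT] by a meager set. *)
have [||e [V [ee oV Ve VA]]] := pettis A.
- by move=> mA'; apply: nm; rewrite -(setUv A); exact: meagerU.
- by exists setT; [exact: openT|rewrite setYTC].
pose val_pbij (x : sT) : pbij := set_val x.
have {}ee : (set_val e * set_val e)%g = set_val e.
  exact: (congr1 val_pbij ee).
have /nbhs_set_type[W eW WV] : nbhs e V by exact: open_nbhs_nbhs.
have [n nW] := pid_near ee eW; have [b nIb] := not_ideal_parity.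
(* Below [n], [D] copies the domain of [e], which keeps [pid D] in [W]; from [n] on it omits the
   parity class that is not in [I]. *)
pose D := [set i | if (i < n)%N then dom (set_val e) i else odd i <> b].
have SD : Splus (~` I) (pid D).
  suff nID : ~ I (~` D) by split; rewrite /= ?dom_pid ?im_pid.
  apply: contra_not nIb => ID.
  apply: I_sub (I_U ID (I_fin (finite_II n))) => i /= ib.
  (* The parity class is covered by the complement of [D] and the finite set below [n]; were that
     complement in [I], the class would be too. *)
  have [ni|ni] := ltnP i n; [by right|left].
  by rewrite /D /= ltnNge ni /=; apply.
pose s : sT := exist _ (pid D) (mem_set SD).
have /VA[a Aa [c Ac acs]] : V s.
  by apply: WV; apply: nW => i ni; rewrite /D /= ni.
have [k [nk ck ck1]] := Ac n Logic.I.
(* One of [k] and [k.+1] has the parity kept in [D]. There [pid D] is defined but [c], applied first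
   in the product, is not. *)
have [j [nj jb cj]] : exists j,
    [/\ (n <= j)%N, odd j <> b & (set_val c : pbij) j = None].
  have [kb|kb] := pselect (odd k = b); last by exists k.
  by exists k.+1; split; [exact: leqW|rewrite /= kb; case: (b)|].
have : pid D j = Some j by apply/pidP; split=> //; rewrite /D /= ltnNge nj.
have <- : (pinv (set_val a) * set_val c)%g = pid D.
  exact: (congr1 val_pbij acs).
by move=> /pmulP[y]; rewrite cj.
Qed.

End NotPettis.

Theorem theorem5p4 (R : realType) (I : set (set nat))
    (I_ideal : ideal I) (I_proper : ~ I [set: nat])
    (I_fin : forall A : set nat, finite_set A -> I A)
    (I_Fsigma : Fsigma (char_set I)) :
  exists S : inverseSubsemigroup pbij,
    [/\ S = Splus (~` I) :> set pbij,
        polish R (subsemigroup_of S) &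
        ~ pettis_property (subsemigroup_of S)].
Proof.
have [I_sub I_U] := I_ideal; have [F cF IF] := I_Fsigma.
exists (Splus_subsemigroup I_sub).
have SF h : Splus (~` I) h <->
    forall n, ~ F n (domC_char h) /\ ~ F n (domC_char (pinv h)).
  rewrite /Splus/= -dom_pinv -!char_set_domC IF; split.
    by move=> [nh nph] n; split; [move=> Fh; apply: nh|move=> Fh; apply: nph];
      exists n.
  by move=> nF; split=> -[n _]; apply (nF n).
have cc := gdelta_coding cF SF.
(* The empty function has both complements equal to $\mathbb{N}$, which is not in [I]; it provides
   the point needed for the Baire category argument. *)
have S1 : Splus (~` I) (pid set0).
  by split; rewrite ?dom_pid ?im_pid /= setC0.
split=> //; first exact: coding_polish cc.
apply: Splus_not_pettis => //.
have x0 : set_type (Splus (~` I)) by exists (pid set0); exact: mem_set.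
exact: (coding_not_meager cc x0).
Qed.
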